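(* Let $k\ge 2$ be a fixed integer and let $G$ be a graph with $n$ vertices. There exists $d_*\in\{1,2,\ldots,n\}$ such that, letting $V_*$ denote the set of vertices of $G$ with degree in $[d_*/2,d_*]$ and letting $G'$ denote the subgraph of $G$ induced on the vertices of degree at most $d_*$, there exist sets $X_1\subseteq V_*$ and $X_2,\ldots,X_k\subseteq V(G')$ and integers $d_1,\ldots,d_k\in\mathbb{N}$ such that, setting $X_{k+1}=V(G')$: (1) the number of capped $k$-walks in $G$ is at most $O(\log^{k+1} n)$ times the number of $k$-walks $(x_1,\ldots,x_{k+1})$ in $G$ with $x_i\in X_i$ for every $i\in\{1,\ldots,k+1\}$; (2) for each $i\in\{1,\ldots,k\}$, every $v\in X_i$ satisfies $|N(v)\cap X_{i+1}|\in[d_i/2,d_i]$.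
   Context: Fix a total order $\succ$ on the vertices of $G$ such that $u\succ w$ whenever $\deg(u)>\deg(w)$ (ties broken arbitrarily). A $k$-walk is a walk with $k$ edges, $x_0,x_1,\ldots,x_k$. A capped $k$-walk is a $k$-walk $x_0,x_1,\ldots,x_k$ with $x_0\succ x_i$ for all $i\in\{1,\ldots,k\}$. $N(v)$ is the neighborhood of $v$; $\log$ is base 2. *)

(* Defs.v *)
From HB Require Import structures.
From mathcomp Require Import all_boot all_order all_algebra.
From mathcomp Require Import reals exp.

Set Implicit Arguments.
Unset Strict Implicit.
Unset Printing Implicit Defensive.

Import Order.TTheory GRing.Theory Num.Theory.
Local Open Scope ring_scope.

Definition log2 (R : realType) (x : R) : R := ln x / ln 2.

Record simple_graph := SimpleGraph {
  vertex :> finType;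
  adj : rel vertex;
  adj_sym : symmetric adj;
  adj_irrefl : irreflexive adj
}.

Definition half_range (d m : nat) : bool :=
  (d%:R / 2 <= m%:R :> rat) && (m <= d)%N.

Section Graph.
Variable G : simple_graph.

Definition nbhd (v : G) : {set G} := [set w | adj v w].

Definition deg (v : G) : nat := #|nbhd v|.

(* [succ u w] stands for u ≻ w (strict). *)
Definition strict_total_order (succ : rel G) : Prop :=
  [/\ irreflexive succ, transitive succ
    & forall u w : G, u != w -> succ u w || succ w u].

Definition degree_order (succ : rel G) : Prop :=
  strict_total_order succ /\ (forall u w : G, (deg w < deg u)%N -> succ u w).

(* A k-walk has k edges, hence k + 1 (possibly repeated) vertices. *)
Definition is_walk (k : nat) (x : k.+1.-tuple G) : bool := sorted (@adj G) x.

Definition is_capped_walk (succ : rel G) (k : nat) (x : k.+1.-tuple G) : bool :=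
  is_walk x && [forall i : 'I_k.+1, (0 < i)%N ==> succ (tnth x ord0) (tnth x i)].

Definition num_capped_walks (succ : rel G) (k : nat) : nat :=
  #|[set x : k.+1.-tuple G | is_capped_walk succ x]|.

(* The k-walks (x_1, ..., x_{k+1}) with x_i \in X i; tuples are indexed from 0,
   so x_{i+1} is [tnth x i]. *)
Definition num_walks_in (k : nat) (X : nat -> {set G}) : nat :=
  #|[set x : k.+1.-tuple G |
      is_walk x && [forall i : 'I_k.+1, tnth x i \in X i.+1]]|.

Definition Vstar (d : nat) : {set G} := [set v | half_range d (deg v)].

(* Vertex set of the subgraph induced on the vertices of degree at most d. *)
Definition Vlow (d : nat) : {set G} := [set v | (deg v <= d)%N].

End Graph.

(* Main.v *)
Require Import Defs.
From HB Require Import structures.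
From mathcomp Require Import all_boot all_order all_algebra.
From mathcomp Require Import reals exp.

Import Order.TTheory GRing.Theory Num.Theory.
Local Open Scope ring_scope.

(** Every degree-like quantity lies in one of [L = trunc_log 2 n + 1] dyadic
    ranges. Pigeonholing the capped walks first on the dyadic range of the
    degree of [x_0], which determines [d_*], and then, for [i = k, ..., 1], on
    the dyadic range of [#|N(x_i) :&: X_{i+1}|], which determines [d_i] and
    [X_i], loses a factor [L] each time, so [L ^ (k + 1)] in total. In a capped
    walk every vertex has degree at most that of its first vertex, so all its
    vertices lie in [G'], and each of the neighbourhood intersections above
    contains the next vertex of the walk, hence is nonempty. *)

Lemma card_pigeonhole (T : finType) (L : nat) (A : {set T}) (c : T -> nat) :
  {in A, forall x, c x < L}%N ->
  exists a, (#|A| <= L * #|[set x in A | c x == a]|)%N.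
Proof.
move=> cL; case: (set_0Vmem A) => [->|[x0 /cL]]; first by exists 0%N; rewrite cards0.
case: L cL => // L cL _.
have -> : #|A| = (\sum_(a < L.+1) #|[set x in A | c x == a]|)%N.
  rewrite -sum1_card (partition_big (fun x => inord (c x) : 'I_L.+1) predT) //=.
  apply: eq_bigr => a _; rewrite -sum1_card; apply: eq_bigl => x.
  rewrite inE; case: (boolP (x \in A)) => //= xA.
  by rewrite -val_eqE /= inordK ?cL.
pose F a := #|[set x in A | c x == a]|.
have [a _ aP] := arg_maxnP (fun i : 'I_L.+1 => F i) (erefl : xpredT (ord0 : 'I_L.+1)).
exists (a : nat); rewrite -[X in (_ <= X * _)%N]card_ord -sum_nat_const.
by apply: leq_sum => i _; apply: aP.
Qed.

Lemma half_rangeE (d m : nat) : half_range d m = (d <= m.*2)%N && (m <= d)%N.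
Proof.
rewrite /half_range; congr (_ && _).
by rewrite ler_pdivrMr // -natrM ler_nat muln2.
Qed.

Lemma trunc_log_le_log2 (R : realType) (n : nat) :
  (0 < n)%N -> (trunc_log 2 n)%:R <= log2 (n%:R : R).
Proof.
move=> n0; have ln2_gt0 : 0 < ln 2 :> R by rewrite ln_gt0 // ltr1n.
rewrite /log2 ler_pdivlMr // mulr_natl -lnXn // ler_ln ?posrE ?exprn_gt0 ?ltr0n //.
by rewrite -natrX ler_nat trunc_logP.
Qed.

Section DyadicLayers.
Variables (G : simple_graph) (B : {set G}).

(** Since X_i depends only on X_{i+1} and one dyadic exponent, the list of exponents for i, ..., k
    encodes X_i, and its suffixes encode all later sets. *)
Fixpoint layer (s : seq nat) : {set G} :=
  if s is a :: s' then
    [set v in B | (2 ^ a <= #|nbhd v :&: layer s'| < 2 ^ a.+1)%N]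
  else B.

Lemma layer_sub (s : seq nat) : layer s \subset B.
Proof. by case: s => //= a s; apply/subsetP => v; rewrite inE => /andP[]. Qed.

Lemma walk_adj (k i : nat) (x : k.+1.-tuple G) (v0 : G) :
  is_walk x -> (i < k)%N -> adj (nth v0 x i) (nth v0 x i.+1).
Proof. by move=> /(sortedP v0) xw ik; apply: xw; rewrite size_tuple ltnS. Qed.

(** Induction on [m], from the end of the walk backwards: a vertex can be classified only once the
    layer of its successor is fixed. Prepending an exponent to [s] leaves the layers already chosen
    intact. *)
Lemma exists_popular_layers (k m : nat) (W : {set k.+1.-tuple G}) (v0 : G) :
  {in W, forall x, is_walk x} ->
  {in W, forall (x : k.+1.-tuple G) (i : nat), (i <= k)%N -> nth v0 x i \in B} ->
  (m <= k)%N ->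
  exists2 s : seq nat, size s = m &
    (#|W| <= (trunc_log 2 #|G|).+1 ^ m *
      #|[set x in W | [forall j : 'I_m.+1,
           nth v0 x (k - m + j) \in layer (drop j s)]]|)%N.
Proof.
move=> Wwalk WB; elim: m => [|m IHm] mk.
  exists [::] => //; rewrite mul1n subset_leq_card //; apply/subsetP => x xW.
  by rewrite inE xW /=; apply/forallP => j; rewrite WB // subn0 ord1 addn0.
have [s sz_s leW] := IHm (ltnW mk); set W' := [set x in W | _] in leW.
pose c (x : k.+1.-tuple G) :=
  trunc_log 2 #|nbhd (nth v0 x (k - m.+1)) :&: layer s|.
have [|a leW'] := @card_pigeonhole _ (trunc_log 2 #|G|).+1 W' c.
  by move=> x _; rewrite ltnS leq_trunc_log // max_card.
exists (a :: s); first by rewrite /= sz_s.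
apply: (leq_trans leW); rewrite expnSr -mulnA leq_mul2l; apply/orP; right.
apply: (leq_trans leW'); rewrite leq_mul2l /= subset_leq_card //.
have km : (k - m = (k - m.+1).+1)%N by rewrite subnSK.
apply/subsetP => x; rewrite !inE => /andP[/andP[xW /forallP xs] /eqP ca].
rewrite xW /=; apply/forallP => -[[|j] /= jm]; last first.
  by have := xs (Ordinal (jm : (j < m.+1)%N)); rewrite /= km addnS.
rewrite addn0 inE WB ?leq_subr //= -ca trunc_logP //=; first exact: trunc_log_ltn.
(* As [trunc_log 2 0 = 0], an empty intersection would fall in class 0 without meeting its lower
   bound; the next vertex of the walk rules this out. *)
apply/card_gt0P; exists (nth v0 x (k - m)).
rewrite !inE km walk_adj ?Wwalk //=; last by rewrite -km leq_subr.
by have := xs ord0; rewrite /= drop0 addn0 km.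
Qed.

End DyadicLayers.

(** A later vertex of larger degree would lie above the first one, which lies above it by capping: a
    cycle in a strict order. *)
Lemma capped_walk_deg (G : simple_graph) (succ : rel G) (k i : nat)
    (x : k.+1.-tuple G) (v0 : G) :
  degree_order succ -> is_capped_walk succ x -> (i <= k)%N ->
  (deg (nth v0 x i) <= deg (nth v0 x 0))%N.
Proof.
move=> [[irr tr _] degP] /andP[_ /forallP xc] ik.
case: i ik => [|i] ik //; rewrite leqNgt; apply/negP => /degP.
have := xc (Ordinal (ik : (i.+1 < k.+1)%N)); rewrite !(tnth_nth v0) /=.
by move=> /tr h /h; rewrite irr.
Qed.

Theorem lemma2p1 (R : realType) (k : nat) (hk : (2 <= k)%N) :
  exists C : R, 0 < C /\
  forall (G : simple_graph) (succ : rel G),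
    (0 < #|G|)%N -> degree_order succ ->
  exists dstar : nat, (1 <= dstar <= #|G|)%N /\
  exists (X : nat -> {set G}) (d : nat -> nat),
    [/\ X 1%N \subset Vstar G dstar,
        forall i : nat, (2 <= i <= k)%N -> X i \subset Vlow G dstar,
        X k.+1 = Vlow G dstar,
        (num_capped_walks succ k)%:R
          <= C * log2 (#|G|%:R : R) ^+ k.+1 * (num_walks_in k X)%:R
      & forall i : nat, (1 <= i <= k)%N ->
          (0 < d i)%N /\
          forall v : G, v \in X i -> half_range (d i) #|nbhd v :&: X i.+1| ].
Proof.
(* Each of the k + 1 pigeonhole factors [L] is at most 2 log n once n is at least 2. *)
exists (2 ^+ k.+1); split=> [|G succ n0 succP]; first exact: exprn_gt0.
have /card_gt0P[v0 _] := n0; set n := #|G| in n0 *.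
have k0 : (0 < k)%N by apply: leq_trans hk.
set L := (trunc_log 2 n).+1.
pose A := [set x : k.+1.-tuple G | is_capped_walk succ x].
have A_adj : {in A, forall x : k.+1.-tuple G, adj (nth v0 x 0) (nth v0 x 1)}.
  by move=> x; rewrite inE => /andP[xw _]; apply: walk_adj.
have A_deg_gt0 : {in A, forall x : k.+1.-tuple G, 0 < deg (nth v0 x 0)}%N.
  by move=> x /A_adj xy; apply/card_gt0P; exists (nth v0 x 1); rewrite inE.
pose c (x : k.+1.-tuple G) := trunc_log 2 (deg (nth v0 x 0)).
have [|j leA] := @card_pigeonhole _ L A c.
  by move=> x _; rewrite ltnS leq_trunc_log // max_card.
(* The minimum with [n] ensures d_* <= n; degrees never exceed [n], so no walk is lost. *)
set W := [set x in A | _] in leA; set dstar := minn (2 ^ j.+1) n.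
have WA : {in W, forall x, x \in A} by move=> x; rewrite inE => /andP[].
have W_deg : {in W, forall x : k.+1.-tuple G, 2 ^ j <= deg (nth v0 x 0) <= dstar}%N.
  move=> x xW; have d0 := A_deg_gt0 _ (WA _ xW).
  move: xW; rewrite inE /dstar => /andP[_ /eqP <-].
  by rewrite trunc_logP //= leq_min max_card andbT; exact: ltnW (trunc_log_ltn _ _).
have W_star : {in W, forall x : k.+1.-tuple G, nth v0 x 0 \in Vstar G dstar}.
  move=> x /W_deg /andP[dj dd]; rewrite inE half_rangeE dd andbT geq_min.
  by rewrite expnS mul2n leq_double dj.
have [x|x xW i ik|//|s sz_s leW] := @exists_popular_layers G (Vlow G dstar) k k W v0.
- by move=> /WA; rewrite inE => /andP[].
- have := WA _ xW; rewrite !inE => xc.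
  by apply: leq_trans (capped_walk_deg _ _ _ _ _ v0 succP xc ik) _; case/andP: (W_deg _ xW).
exists dstar; split; first by rewrite leq_min expn_gt0 n0 geq_minr.
(* Intersecting with V_* keeps every walk of [W], and no neighbourhood count in (2) involves X_1, so
   shrinking it is harmless. *)
pose X i := if i == 1%N then layer _ (Vlow G dstar) s :&: Vstar G dstar
            else layer _ (Vlow G dstar) (drop i.-1 s).
exists X, (fun i => 2 ^ (nth 0 s i.-1).+1)%N.
have X_layer i : X i \subset layer _ (Vlow G dstar) (drop i.-1 s).
  by rewrite /X; case: eqP => [->|_] //; rewrite drop0 subsetIl.
split.
- by rewrite /X eqxx subsetIr.
- by move=> i _; apply: subset_trans (X_layer i) (layer_sub _ _ _).
- by rewrite /X eqSS (gtn_eqF k0) /= -sz_s drop_size.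
- have leN : (num_capped_walks succ k <= L ^ k.+1 * num_walks_in k X)%N.
    apply: (leq_trans leA); rewrite expnS -mulnA leq_mul2l /=.
    apply: (leq_trans leW); rewrite leq_mul2l; apply/orP; right.
    apply/subset_leq_card/subsetP => x; rewrite inE => /andP[xW /forallP xs].
    have := WA _ xW; rewrite !inE => /andP[-> _] /=.
    apply/forallP => i; have := xs i; rewrite subnn add0n (tnth_nth v0) /X eqSS /=.
    by case: eqP => [->|//]; rewrite drop0 inE W_star // andbT.
  (* For n = 1 the logarithm vanishes, so the bound needs the count to be zero; a capped walk
     provides an edge and hence n > 1. *)
  have [N0|N_gt0] := posnP (num_capped_walks succ k).
    rewrite N0 !mulr_ge0 ?exprn_ge0 //.
    by apply: le_trans (trunc_log_le_log2 R n n0); rewrite ler0n.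
  have n_gt1 : (1 < n)%N.
    have /card_gt0P[x /A_adj xy] := N_gt0.
    rewrite /n ltnNge; apply/negP => /card_le1P/(_ (nth v0 x 0) isT (nth v0 x 1)).
    by rewrite !inE => /esym/eqP e; move: xy; rewrite e adj_irrefl.
  apply: (@le_trans _ _ (L ^ k.+1 * num_walks_in k X)%:R); first by rewrite ler_nat.
  rewrite natrM natrX -exprMn ler_wpM2r // lerXn2r ?nnegrE //.
    by rewrite mulr_ge0 // (le_trans _ (trunc_log_le_log2 R n n0)).
  (* The extra 1 in [L] is absorbed because [trunc_log 2 n] is at least 1. *)
  apply: (@le_trans _ _ (2 * (trunc_log 2 n)%:R)).
    rewrite -natrM ler_nat mul2n -addnn /L -addn1 leq_add2l.
    by rewrite -[1%N]/(trunc_log 2 2) leq_trunc_log.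
  by rewrite ler_wpM2l // trunc_log_le_log2.
- case=> // i /= ik; split; first by rewrite expn_gt0.
  move=> v /(subsetP (X_layer _)) /=.
  have -> : X i.+2 = layer _ (Vlow G dstar) (drop i.+1 s) by [].
  rewrite (drop_nth 0%N) ?sz_s //= inE => /and3P[_ lo hi].
  by rewrite half_rangeE (ltnW hi) andbT expnS mul2n leq_double.
Qed.
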